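(* Let $\mathfrak{g}=sl(n)$ and let $f$ be the quadratic invariant bracket on $\mathfrak{g}^*$ given by the (unique up to a factor) invariant map $f:\wedge^2\mathfrak{g}\to S^2\mathfrak{g}$. Then $f$ is strongly restricted on any orbit of $SL(n)$ in $\mathfrak{g}^*$.
   Context: $\mathfrak{g}=sl(n,\mathbb{C})$, with $SL(n)$ acting on $\mathfrak{g}^*$ by the coadjoint action; the symmetric algebra $S\mathfrak{g}$ is the function algebra on $\mathfrak{g}^*$. A bracket on $\mathfrak{g}^*$ is a skew-symmetric bilinear map $S\mathfrak{g}\otimes S\mathfrak{g}\to S\mathfrak{g}$ that is a derivation in each argument (equivalently a bivector field); it is invariant if it commutes with the action of $\mathfrak{g}$. A linear map $\wedge^2\mathfrak{g}\to S^2\mathfrak{g}$ commuting with $\mathfrak{g}$ extends uniquely by the Leibniz rule to an invariant (quadratic) bracket on $\mathfrak{g}^*$; for $\mathfrak{g}=sl(n)$ such a map is unique up to a scalar factor. The bracket $f$ is the invariant part of the Poisson bracket along $h$, $p=f-\{\cdot,\cdot\}_r$, of the two-parameter quantization of $S\mathfrak{g}$. A $k$-vector field $g$ on a manifold $M$ is strongly restricted on a submanifold $N\subset M$ if at every point $x\in N$ the polyvector $g_x$ belongs to $\wedge^kT_xN\subset\wedge^kT_xM$. *)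

(* Defs.v *)
From HB Require Import structures.
From mathcomp Require Import all_boot all_order all_algebra.
From mathcomp Require Import boolp classical_sets reals topology normedtype derive.
(* mpoly's notations clash with those of MathComp-Analysis, so they are left
   out: mpoly n K is {mpoly K[n]}, mpolyX K (mnm1 i) is 'X_i, meval v p is
   p.@[v] and ishomog1 d mdeg is d.-homog. *)
From mathcomp Require Import -(notations) mpoly.

Set Implicit Arguments.
Unset Strict Implicit.
Unset Printing Implicit Defensive.

Import Order.TTheory GRing.Theory Num.Theory.
Import numFieldNormedType.Exports.
Local Open Scope classical_set_scope.
Local Open Scope ring_scope.

Section SpecialLinear.
Variables (K : numFieldType) (n : nat).

Definition slv : {vspace 'M[K]_n} :=
  lker (linfun (fun A : 'M[K]_n => \tr A : K^o)).

Definition sl : vectType K := subvs_of slv.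

Lemma mem_slv (A : 'M[K]_n) : (A \in slv) = (\tr A == 0).
Proof. by rewrite memv_ker lfunE. Qed.

(* vsproj slv only serves to coerce traceless matrices into sl: see val_lieb
   and val_Ad. *)
Definition lieb (a b : sl) : sl :=
  vsproj slv (vsval a *m vsval b - vsval b *m vsval a).

Lemma val_lieb (a b : sl) :
  vsval (lieb a b) = vsval a *m vsval b - vsval b *m vsval a.
Proof. by rewrite vsprojK // mem_slv raddfB /= mxtrace_mulC subrr. Qed.

Definition Ad (P : 'M[K]_n) (a : sl) : sl :=
  vsproj slv (P *m vsval a *m invmx P).

Lemma val_Ad (P : 'M[K]_n) (a : sl) :
  P \in unitmx -> vsval (Ad P a) = P *m vsval a *m invmx P.
Proof.
move=> uP; rewrite vsprojK // mem_slv mxtrace_mulC mulmxA mulVmx // mul1mx.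
by rewrite -mem_slv subvsP.
Qed.

Fact Ad_is_linear P : linear (Ad P).
Proof. by move=> c a b; rewrite /Ad !linearP /= mulmxDl -scalemxAl linearP. Qed.
HB.instance Definition _ P := GRing.isLinear.Build K sl sl _ (Ad P)
  (Ad_is_linear P).

Definition sl_dual : vectType K := 'Hom(sl, K^o).

(* (P . x)(a) = x (P^-1 a P) *)
Definition coadj (P : 'M[K]_n) (x : sl_dual) : sl_dual :=
  (x \o linfun (Ad (invmx P)))%VF.

Definition coadj_orbit (x : sl_dual) : set sl_dual :=
  [set coadj P x | P in [set P : 'M[K]_n | \det P = 1]].

(* The symmetric algebra of sl, presented as the polynomial ring on a basis. *)
Definition slb : (\dim {: sl}).-tuple sl := vbasis {: sl}.

Definition Sg := mpoly (\dim {: sl}) K.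

Definition sym_inj (a : sl) : Sg :=
  \sum_(i < \dim {: sl}) coord slb i a *: mpolyX K (mnm1 i).

Definition sym_eval (x : sl_dual) (F : Sg) : K :=
  meval (fun i => x slb`_i : K) F.

Lemma sym_eval_inj x a : sym_eval x (sym_inj a) = x a.
Proof.
rewrite /sym_eval /sym_inj raddf_sum /= [in RHS](coord_vbasis (memvf a)).
rewrite linear_sum; apply: eq_bigr => i _.
by rewrite mevalZ mevalXU linearZ.
Qed.

(* The extension of ad a to a derivation of the symmetric algebra. *)
Definition sym_ad (a : sl) (F : Sg) : Sg :=
  \sum_(i < \dim {: sl}) sym_inj (lieb a slb`_i) * mderiv i F.

(* A linear map from the exterior square of sl to its second symmetric power
   is given as an alternating bilinear map with values in the quadratic
   polynomials. *)
Definition invariant_wedge2_S2 (phi : sl -> sl -> Sg) : Prop :=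
  [/\ (forall b, linear (phi^~ b)) /\ (forall a, linear (phi a)),
      forall a, phi a a = 0,
      forall a b, phi a b \is ishomog1 2 mdeg
    & forall c a b, sym_ad c (phi a b) = phi (lieb c a) b + phi a (lieb c b)].

Definition is_bracket (br : Sg -> Sg -> Sg) : Prop :=
  [/\ (forall G, linear (br^~ G)) /\ (forall F, linear (br F)),
      forall F G, br G F = - br F G,
      forall F G H, br (F * G) H = F * br G H + br F H * G
    & forall F G H, br F (G * H) = G * br F H + br F G * H].

(* The bracket br is the Leibniz extension of phi. *)
Definition extends (br : Sg -> Sg -> Sg) (phi : sl -> sl -> Sg) : Prop :=
  is_bracket br /\ forall a b, br (sym_inj a) (sym_inj b) = phi a b.

(* The bivector at x attached to a bracket, as a bilinear form on the
   cotangent space of sl_dual at x; the latter is sl, a being the differential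
   of the linear function sym_inj a. *)
Definition bivector_at (br : Sg -> Sg -> Sg) (x : sl_dual) (a b : sl) : K :=
  sym_eval x (br (sym_inj a) (sym_inj b)).

(* Velocities at x of the K-differentiable curves drawn on N: this is the
   tangent space when K is the field of complex numbers and N is a complex
   submanifold. Differentiability of a curve g in the finite-dimensional space
   sl_dual is tested on its coordinates g t a. *)
Definition tangent (N : set sl_dual) (x : sl_dual) : set sl_dual :=
  [set v | exists g : K^o -> sl_dual,
    [/\ g 0 = x,
        \forall t \near (0 : K^o), N (g t),
        \forall t \near (0 : K^o), forall a,
          derivable (fun s : K^o => g s a : K^o) t (1 : K^o)
      & forall a, is_derive (0 : K^o) (1 : K^o) (fun s => g s a : K^o) (v a)]].

(* Membership in the exterior square of T, inside the exterior square of
   sl_dual viewed as the alternating bilinear forms on sl. *)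
Definition wedge2 (T : set sl_dual) (B : sl -> sl -> K) : Prop :=
  exists (m : nat) (u v : 'I_m -> sl_dual),
    (forall k, T (u k) /\ T (v k)) /\
    forall a b, B a b = \sum_(k < m) (u k a * v k b - u k b * v k a).

Definition strongly_restricted (br : Sg -> Sg -> Sg) (N : set sl_dual) : Prop :=
  forall x, N x -> wedge2 (tangent N x) (bivector_at br x).

End SpecialLinear.

(* Main.v *)
Require Import Defs.
From HB Require Import structures.
From mathcomp Require Import all_boot all_order all_algebra.
From mathcomp Require Import ring.
From mathcomp Require Import complex.
From mathcomp Require Import boolp classical_sets functions reals topology normedtype derive.
From mathcomp Require Import -(notations) mpoly.

(* Identify g with g^* by the trace form and polarize f into a quadrilinear
   form T(a, b, y, z), alternating in a, b, symmetric in y, z and killed by the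
   infinitesimal action of g. Evaluating this invariance on matrix units shows
   that T vanishes when all arguments are diagonal (the exterior square of the
   reflection representation of S_n does not occur in its symmetric square), and
   that T(E_ij, E_ji, y, y) = t (y_j^2 - y_i^2) for y diagonal and traceless.
   Hence T + (t/2) tr([a, b](yz + zy)) vanishes for y, z diagonal, and so
   everywhere, because S^2 g is generated by S^2 of the diagonal subalgebra.
   Consequently the bivector of f at y is proportional to tr([a, b] y^2), which
   is zero when a commutes with y. The conormal space of the orbit at y, being the
   centralizer of y, is thus in the radical of the bivector, which therefore lies
   in the exterior square of the tangent space. That space is spanned by
   velocities of the curves (1 + s c) y (1 - s c) with c^2 = 0. *)

Set Implicit Arguments.
Unset Strict Implicit.
Unset Printing Implicit Defensive.

Import Order.TTheory GRing.Theory Num.Theory.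
Import numFieldNormedType.Exports.
Local Open Scope ring_scope.

(** * Invariant forms on matrices *)

Section InvariantForms.
Variables (K : numFieldType) (n : nat).
Implicit Types (a b c y z A B : 'M[K]_n) (d v w : 'rV[K]_n) (i j k l : 'I_n) (t : K).

Definition mxcomm A B := A *m B - B *m A.

Lemma mxcomm_delta i j k l :
  mxcomm (delta_mx i j) (delta_mx k l) =
  (j == k)%:R *: delta_mx i l - (l == i)%:R *: delta_mx k j.
Proof. by rewrite /mxcomm !mul_delta_mx_cond !scaler_nat. Qed.

Lemma mxcomm_delta_diag i j d :
  mxcomm (delta_mx i j) (diag_mx d) = (d 0 j - d 0 i) *: delta_mx i j.
Proof.
rewrite /mxcomm; apply/matrixP => p q; rewrite mul_mx_diag mul_diag_mx !mxE.
by case: (eqVneq p i) => [->|_] /=; case: (eqVneq q j) => [->|_] /=; ring.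
Qed.

Lemma mxcomm_diag_delta i j d :
  mxcomm (diag_mx d) (delta_mx i j) = (d 0 i - d 0 j) *: delta_mx i j.
Proof.
by rewrite -[LHS]opprB -/(mxcomm _ _) mxcomm_delta_diag -scaleNr opprB.
Qed.

Lemma mxcomm_diag d v : mxcomm (diag_mx d) (diag_mx v) = 0.
Proof. by rewrite /mxcomm diag_mxC subrr. Qed.

Lemma delta_diag i : delta_mx i i = diag_mx (delta_mx 0 i) :> 'M[K]_n.
Proof.
apply/matrixP => p q; rewrite !mxE eqxx /=.
case: (eqVneq p q) => [->|npq]; first by rewrite andbb mulr1n.
rewrite mulr0n; case: (eqVneq p i) => // <-.
by rewrite eq_sym (negbTE npq).
Qed.

Definition coroot i j : 'rV[K]_n := delta_mx 0 i - delta_mx 0 j.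

Lemma sum_delta_row i : \sum_k (delta_mx 0 i : 'rV[K]_n) 0 k = 1.
Proof.
rewrite (bigD1 i) // big1 /= => [|k nki]; rewrite !mxE !eqxx ?addr0 //.
by rewrite (negbTE nki).
Qed.

Lemma sum_coroot i j : \sum_k coroot i j 0 k = 0.
Proof.
under eq_bigr do rewrite [coroot _ _ _ _]mxE [X in _ + X]mxE.
by rewrite sumrB !sum_delta_row subrr.
Qed.

Lemma coroot_l i j : i != j -> coroot i j 0 i = 1.
Proof. by move=> nij; rewrite !mxE !eqxx (negbTE nij) subr0. Qed.

Lemma coroot_r i j : i != j -> coroot i j 0 j = -1.
Proof. by move=> nij; rewrite !mxE !eqxx eq_sym (negbTE nij) sub0r. Qed.

Lemma coroot_out i j k : k != i -> k != j -> coroot i j 0 k = 0.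
Proof. by move=> nki nkj; rewrite !mxE (negbTE nki) (negbTE nkj) subrr. Qed.

Lemma corootC i j : coroot j i = - coroot i j.
Proof. by rewrite opprB. Qed.

Lemma mxcomm_root i j :
  mxcomm (delta_mx i j) (delta_mx j i) = diag_mx (coroot i j).
Proof.
by rewrite mxcomm_delta !eqxx !scale1r [RHS]raddfB /= !delta_diag.
Qed.

(** The arguments range over gl_n, so that single units E_ii may be inserted; descent of the first
    slot modulo scalars is the separate condition that [T 1%:M] vanish. Linearity passes to slots
    two and four through [form_alt] and [form_sym]. *)
Record invariant_form (T : 'M[K]_n -> 'M[K]_n -> 'M[K]_n -> 'M[K]_n -> K) :
    Prop := InvariantForm {
  form_lin1 : forall b y z t a a',
    T (t *: a + a') b y z = t * T a b y z + T a' b y z;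
  form_lin3 : forall a b z t y y',
    T a b (t *: y + y') z = t * T a b y z + T a b y' z;
  form_alt : forall a b y z, T b a y z = - T a b y z;
  form_sym : forall a b y z, T a b z y = T a b y z;
  form_inv : forall c a b y z,
    T (mxcomm c a) b y z + T a (mxcomm c b) y z
    + T a b (mxcomm c y) z + T a b y (mxcomm c z) = 0 }.

(** The defect of invariance is symmetric and biadditive in y, z, so in characteristic zero its
    vanishing at y = z forces it to vanish everywhere. *)
Lemma quadratic_invariant_form (T : 'M[K]_n -> 'M[K]_n -> 'M[K]_n -> 'M[K]_n -> K) :
  (forall b y z t a a', T (t *: a + a') b y z = t * T a b y z + T a' b y z) ->
  (forall a y z b b', T a (b + b') y z = T a b y z + T a b' y z) ->
  (forall a b z t y y', T a b (t *: y + y') z = t * T a b y z + T a b y' z) ->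
  (forall a y z, T a a y z = 0) ->
  (forall a b y z, T a b z y = T a b y z) ->
  (forall c a b y, T (mxcomm c a) b y y + T a (mxcomm c b) y y
                   + 2 * T a b (mxcomm c y) y = 0) ->
  invariant_form T.
Proof.
move=> lin1 add2 lin3 diag sym inv.
have add1 a a' b y z : T (a + a') b y z = T a b y z + T a' b y z.
  by rewrite -[a]scale1r lin1 mul1r scale1r.
have add3 a b y y' z : T a b (y + y') z = T a b y z + T a b y' z.
  by rewrite -[y]scale1r lin3 mul1r scale1r.
have add4 a b y z z' : T a b y (z + z') = T a b y z + T a b y z'.
  by rewrite sym add3 !(sym _ _ y).
split=> // [a b y z|c a b y z].
  apply/eqP; rewrite -addr_eq0 -(diag (a + b) y z).
  by rewrite add2 !add1 !diag add0r addr0.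
pose D y z := T (mxcomm c a) b y z + T a (mxcomm c b) y z
  + T a b (mxcomm c y) z + T a b y (mxcomm c z).
have D0 y' : D y' y' = 0.
  by rewrite /D (sym a b (mxcomm c y') y') -[RHS](inv c a b y'); ring.
have commD A B : mxcomm c (A + B) = mxcomm c A + mxcomm c B.
  by rewrite /mxcomm mulmxDr mulmxDl opprD addrACA.
have D2 : D (y + z) (y + z) = D y y + D z z + D y z *+ 2.
  rewrite /D !commD; move: (mxcomm c y) (mxcomm c z) => cy cz.
  rewrite !add3 !add4 !(sym _ _ y z).
  by rewrite (sym a b y cz) (sym a b cy z); ring.
by move: D2; rewrite !D0 !add0r => /esym/eqP; rewrite mulrn_eq0 /= => /eqP.
Qed.

(** * Values on diagonal matrices and root vectors *)

Section FormTheory.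
Variable T : 'M[K]_n -> 'M[K]_n -> 'M[K]_n -> 'M[K]_n -> K.
Hypothesis HT : invariant_form T.

Let alt := form_alt HT.
Let sym := form_sym HT.
Let inv := form_inv HT.

Lemma form1D b y z a a' : T (a + a') b y z = T a b y z + T a' b y z.
Proof. by rewrite -[a]scale1r form_lin1 // mul1r scale1r. Qed.

Lemma form10 b y z : T 0 b y z = 0.
Proof. by apply: (addrI (T 0 b y z)); rewrite -form1D !addr0. Qed.

Lemma form1Z b y z t a : T (t *: a) b y z = t * T a b y z.
Proof. by rewrite -[t *: a]addr0 form_lin1 // form10 addr0. Qed.

Lemma form1N b y z a : T (- a) b y z = - T a b y z.
Proof. by rewrite -scaleN1r form1Z mulN1r. Qed.

Lemma form1_sum b y z (I : finType) (P : pred I) (F : I -> 'M_n) :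
  T (\sum_(i | P i) F i) b y z = \sum_(i | P i) T (F i) b y z.
Proof.
by apply: (big_morph (fun x => T x b y z)) => [x x'|]; rewrite ?form1D ?form10.
Qed.

Lemma form2D a y z b b' : T a (b + b') y z = T a b y z + T a b' y z.
Proof. by rewrite alt form1D opprD -!alt. Qed.

Lemma form20 a y z : T a 0 y z = 0.
Proof. by rewrite alt form10 oppr0. Qed.

Lemma form2Z a y z t b : T a (t *: b) y z = t * T a b y z.
Proof. by rewrite alt form1Z -mulrN -alt. Qed.

Lemma form2N a y z b : T a (- b) y z = - T a b y z.
Proof. by rewrite -scaleN1r form2Z mulN1r. Qed.

Lemma form2_sum a y z (I : finType) (P : pred I) (F : I -> 'M_n) :
  T a (\sum_(i | P i) F i) y z = \sum_(i | P i) T a (F i) y z.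
Proof.
by apply: (big_morph (fun x => T a x y z)) => [x x'|]; rewrite ?form2D ?form20.
Qed.

Lemma form3D a b z y y' : T a b (y + y') z = T a b y z + T a b y' z.
Proof. by rewrite -[y]scale1r form_lin3 // mul1r scale1r. Qed.

Lemma form30 a b z : T a b 0 z = 0.
Proof. by apply: (addrI (T a b 0 z)); rewrite -form3D !addr0. Qed.

Lemma form3Z a b z t y : T a b (t *: y) z = t * T a b y z.
Proof. by rewrite -[t *: y]addr0 form_lin3 // form30 addr0. Qed.

Lemma form3N a b z y : T a b (- y) z = - T a b y z.
Proof. by rewrite -scaleN1r form3Z mulN1r. Qed.

Lemma form3_sum a b z (I : finType) (P : pred I) (F : I -> 'M_n) :
  T a b (\sum_(i | P i) F i) z = \sum_(i | P i) T a b (F i) z.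
Proof.
by apply: (big_morph (fun x => T a b x z)) => [x x'|]; rewrite ?form3D ?form30.
Qed.

Lemma form4D a b y z z' : T a b y (z + z') = T a b y z + T a b y z'.
Proof. by rewrite sym form3D !(sym _ _ y). Qed.

Lemma form40 a b y : T a b y 0 = 0.
Proof. by rewrite sym form30. Qed.

Lemma form4Z a b y t z : T a b y (t *: z) = t * T a b y z.
Proof. by rewrite sym form3Z sym. Qed.

Lemma form4N a b y z : T a b y (- z) = - T a b y z.
Proof. by rewrite -scaleN1r form4Z mulN1r. Qed.

Lemma form4_sum a b y (I : finType) (P : pred I) (F : I -> 'M_n) :
  T a b y (\sum_(i | P i) F i) = \sum_(i | P i) T a b y (F i).
Proof.
by apply: (big_morph (T a b y)) => [x x'|]; rewrite ?form4D ?form40.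
Qed.

Lemma form_diag a y z : T a a y z = 0.
Proof.
have /eqP := alt a a y z; rewrite -addr_eq0 -mulr2n mulrn_eq0 /=.
by move/eqP.
Qed.

Let formE := (form1D, form1Z, form1N, form10, form2D, form2Z, form2N, form20,
  form3D, form3Z, form3N, form30, form4D, form4Z, form4N, form40).

(** Two helpers that prove [x = 0] from null relations: [lcomb] accumulates a linear combination of
    them, and [lcomb2] asks it to equal twice [x]. *)
Let lcomb2 (x u : K) : u = 0 -> x *+ 2 = u -> x = 0.
Proof. by move=> -> /eqP; rewrite mulrn_eq0 /= => /eqP. Qed.

Let lcomb (x : K) (hx : x = 0) (t u : K) : u = 0 -> x + t * u = 0.
Proof. by rewrite hx => ->; rewrite mulr0 addr0. Qed.

(** Invariance under E_ij at the arguments d, E_ji, v, w: it ties diagonal values containing a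
    coroot to values containing a pair of opposite root vectors. *)
Lemma form_root i j d v w :
  (d 0 j - d 0 i) * T (delta_mx i j) (delta_mx j i) (diag_mx v) (diag_mx w)
  + T (diag_mx d) (diag_mx (coroot i j)) (diag_mx v) (diag_mx w)
  + (v 0 j - v 0 i) * T (diag_mx d) (delta_mx j i) (delta_mx i j) (diag_mx w)
  + (w 0 j - w 0 i) * T (diag_mx d) (delta_mx j i) (diag_mx v) (delta_mx i j)
  = 0.
Proof.
have := inv (delta_mx i j) (diag_mx d) (delta_mx j i) (diag_mx v) (diag_mx w).
by rewrite mxcomm_root !mxcomm_delta_diag !formE.
Qed.

(* This lemma and the next one express invariance under the reflection that
   exchanges i and j: a form with an odd number of coroots vanishes. *)
Lemma form_coroot_fix i j d v w : i != j -> v 0 i = v 0 j -> w 0 i = w 0 j ->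
  T (diag_mx d) (diag_mx (coroot i j)) (diag_mx v) (diag_mx w) = 0.
Proof.
move=> nij vij wij.
(* Putting d = -h_ij kills the coroot term by alternation and leaves the factor d_j - d_i = 2. *)
have e0 : T (delta_mx i j) (delta_mx j i) (diag_mx v) (diag_mx w) = 0.
  apply: (lcomb2 (form_root i j (- coroot i j) v w)).
  rewrite vij wij !subrr !mul0r !addr0 raddfN /= form1N form_diag oppr0 addr0.
  rewrite [(- coroot i j) 0 j]mxE [(- coroot i j) 0 i]mxE coroot_l // coroot_r //.
  ring.
by have := form_root i j d v w; rewrite e0 vij wij !subrr !mul0r !addr0 mulr0 add0r.
Qed.

Lemma form_coroot3 i j d : i != j -> d 0 i = d 0 j ->
  let h := diag_mx (coroot i j) in T (diag_mx d) h h h = 0.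
Proof.
move=> nij dij h.
pose e := delta_mx i j : 'M[K]_n; pose f := delta_mx j i : 'M[K]_n.
set D := diag_mx d.
(* As D commutes with e and f, the relations contain, besides T(D, h, h, h), only T(D, f, h, e),
   T(D, e, h, f) and T(D, h, e, f). The final combination cancels these three. *)
have h1 := form_root i j d (coroot i j) (coroot i j).
have h2 := form_root j i d (coroot i j) (coroot i j).
have h3 := inv e D h h f.
have h5 := inv e D f e f.
rewrite !coroot_l // !coroot_r // dij -/h -/D -/e -/f in h1.
rewrite !coroot_l // !coroot_r // dij (corootC i j) [diag_mx (- _)]raddfN /= form2N in h2.
rewrite -/h -/D -/e -/f in h2.
rewrite mxcomm_root !mxcomm_delta_diag coroot_l // coroot_r // dij in h3.
rewrite !formE -/h -/e in h3.
rewrite mxcomm_root mxcomm_delta_diag /mxcomm subrr dij in h5.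
rewrite !formE -/h in h5.
rewrite ![T D f e h]sym in h1 h5; rewrite ![T D e f h]sym in h2.
apply: (lcomb2 (lcomb (lcomb (lcomb h1 1 h2) 2 h3) 4 h5)); ring.
Qed.

(** All arguments lie in the copy of sl_2 spanned by e, f, h. Its exterior square is V_2 and its
    symmetric square is V_4 + V_0, with no common constituent. *)
Lemma form_root_coroot i j : i != j ->
  let h := diag_mx (coroot i j) in T h (delta_mx j i) h (delta_mx i j) = 0.
Proof.
move=> nij h; pose e := delta_mx i j : 'M[K]_n; pose f := delta_mx j i : 'M[K]_n.
have h1 := form_root i j (coroot i j) (coroot i j) (coroot i j).
have h2 := form_root j i (coroot i j) (coroot i j) (coroot i j).
have h3 := inv e e f h f.
have h4 := inv e h f e f.
rewrite !coroot_l // !coroot_r // -/h -/e -/f form_diag in h1.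
rewrite !coroot_l // !coroot_r // (corootC i j) [diag_mx (- _)]raddfN /= form2N in h2.
rewrite -/h -/e -/f form_diag in h2.
rewrite mxcomm_root mxcomm_delta_diag /mxcomm subrr coroot_l // coroot_r // in h3.
rewrite !formE -/h -/e in h3.
rewrite mxcomm_root mxcomm_delta_diag /mxcomm subrr coroot_l // coroot_r // in h4.
rewrite !formE -/h -/e form_diag in h4.
rewrite ![T h f e h]sym in h1 h4; rewrite ![T h e f h]sym in h2.
rewrite [T f e h h]alt in h2; rewrite [T e h h f]alt in h3.
by apply: (lcomb2 (lcomb (lcomb (lcomb h4 (-1) h3) (- 4^-1) h1) (- 4^-1) h2)); field.
Qed.

(** Reflections make the indices outside {k, l} interchangeable in the second slot. As [T] is zero
    on the identity, summing over that slot settles every case except i, j both in {k, l}, where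
    [in2] uses the reflection exchanging them. *)
Lemma form_diag_mx_delta i j k l :
  (forall b y z, T 1%:M b y z = 0) ->
  T (delta_mx i i) (delta_mx j j) (delta_mx k k) (delta_mx l l) = 0.
Proof.
move=> T1.
(* E_qq - E_rr is a coroot whose reflection fixes the last two arguments. *)
have nearby p q r k' l' : k' != q -> k' != r -> l' != q -> l' != r ->
    T (delta_mx p p) (delta_mx q q) (delta_mx k' k') (delta_mx l' l') =
    T (delta_mx p p) (delta_mx r r) (delta_mx k' k') (delta_mx l' l').
  move=> nkq nkr nlq nlr; case: (eqVneq q r) => [->//|nqr].
  apply/eqP; rewrite -subr_eq0 -form2N -form2D !delta_diag -raddfB /=.
  apply/eqP; rewrite form_coroot_fix // !mxE /=.
    by rewrite ![_ == k']eq_sym (negbTE nkq) (negbTE nkr).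
  by rewrite ![_ == l']eq_sym (negbTE nlq) (negbTE nlr).
have in2 p q : p != q ->
    T (delta_mx p p) (delta_mx q q) (delta_mx p p) (delta_mx q q) = 0.
  (* For P = E_pp, Q = E_qq, s = P + Q and h = P - Q, the first two slots (s, h) give -2 T(P, Q).
     Comparing (s, s) with (h, h) in the last two slots isolates the mixed term. *)
  move=> npq; pose s := delta_mx 0 p + delta_mx 0 q : 'rV[K]_n.
  have spq : s 0 p = s 0 q by rewrite !mxE !eqxx (negbTE npq) eq_sym (negbTE npq) addrC.
  have h1 := form_coroot_fix s npq spq spq.
  have h2 := form_coroot3 npq spq.
  have [h3 h4] := (form_diag (diag_mx (coroot p q)), form_diag (diag_mx s)).
  move: h1 h2; rewrite /s /coroot !raddfD !raddfN /= -!delta_diag.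
  set P := delta_mx p p; set Q := delta_mx q q; rewrite !formE.
  rewrite !form_diag !(alt P Q) ![T P Q Q P]sym => h1 h2.
  by apply: (lcomb2 (lcomb (lcomb (erefl 0) (4^-1) h2) (- 4^-1) h1)); field.
have in2C p q : p != q ->
    T (delta_mx p p) (delta_mx q q) (delta_mx q q) (delta_mx p p) = 0.
  by move=> npq; rewrite sym in2.
have out p q k' l' : q != k' -> q != l' ->
    T (delta_mx p p) (delta_mx q q) (delta_mx k' k') (delta_mx l' l') = 0.
  move=> nqk nql.
  have [/andP[npk npl]|] := boolP ((p != k') && (p != l')).
    by rewrite (nearby _ _ p) ?form_diag // eq_sym.
  rewrite negb_and !negbK => pkl.
  (* Now p is k' or l'. The terms with r in {k', l'} vanish and all others equal the wanted value,
     so a positive multiple of it is zero. *)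
  have : \sum_r T (delta_mx p p) (delta_mx r r) (delta_mx k' k') (delta_mx l' l') = 0.
    by rewrite -form2_sum -mx1_sum_delta alt T1 oppr0.
  rewrite (bigID (fun r => (r != k') && (r != l'))) /= [X in _ + X]big1 ?addr0.
    rewrite (eq_bigr (fun=> T (delta_mx p p) (delta_mx q q) (delta_mx k' k')
        (delta_mx l' l'))) => [|r /andP[nrk nrl]]; last first.
      by apply: nearby; rewrite // eq_sym.
    rewrite sumr_const => /eqP; rewrite mulrn_eq0 => /orP[|/eqP //].
    by move=> /eqP/card0_eq/(_ q); rewrite unfold_in /= nqk nql.
  move=> r; rewrite negb_and !negbK => rkl.
  case: (eqVneq p r) => [->|npr]; first by rewrite form_diag.
  case/orP: pkl rkl => /eqP <-; case/orP => /eqP er; subst r => //.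
  - by rewrite eqxx in npr.
  - by rewrite in2.
  - by rewrite in2C.
  - by rewrite eqxx in npr.
have [/andP[njk njl]|] := boolP ((j != k) && (j != l)); first exact: out.
rewrite negb_and !negbK => jkl.
have [/andP[nik nil]|] := boolP ((i != k) && (i != l)); first by rewrite alt out ?oppr0.
rewrite negb_and !negbK => ikl.
case: (eqVneq i j) => [->|nij]; first by rewrite form_diag.
case/orP: ikl jkl => /eqP ei; case/orP => /eqP ej; subst i j.
- by rewrite eqxx in nij.
- by rewrite in2.
- by rewrite in2C.
- by rewrite eqxx in nij.
Qed.

Lemma form_diag_mx (T1 : forall b y z, T 1%:M b y z = 0) d d' v w :
  T (diag_mx d) (diag_mx d') (diag_mx v) (diag_mx w) = 0.
Proof.
have E u : diag_mx u = \sum_i u 0 i *: delta_mx i i :> 'M[K]_n.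
  rewrite {1}[u]row_sum_delta linear_sum; apply: eq_bigr => i _.
  by rewrite linearZ /= delta_diag.
rewrite !E form1_sum big1 // => i _; rewrite form2_sum big1 // => j _.
rewrite form3_sum big1 // => k _; rewrite form4_sum big1 // => l _.
by rewrite form1Z form2Z form3Z form4Z form_diag_mx_delta // !mulr0.
Qed.

(** The left side is (v_j - v_i) L(v) with L linear. L has one value on E_ii and E_jj and one on all
    other E_kk, so on traceless v it is a multiple of v_i + v_j. *)
Lemma form_root_pair i j : i != j -> exists t, forall v, \sum_k v 0 k = 0 ->
  T (delta_mx i j) (delta_mx j i) (diag_mx v) (diag_mx v)
  = t * (v 0 j ^+ 2 - v 0 i ^+ 2).
Proof.
move=> nij.
pose L v := T (diag_mx (coroot i j)) (delta_mx j i) (diag_mx v) (delta_mx i j).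
have LE v : T (delta_mx i j) (delta_mx j i) (diag_mx v) (diag_mx v) =
    (v 0 j - v 0 i) * L v.
  have h := form_root i j (coroot i j) v v.
  rewrite coroot_l // coroot_r // form_diag [T _ _ (delta_mx i j) _]sym in h.
  apply/eqP; rewrite -subr_eq0; apply/eqP; rewrite /L.
  by apply: (lcomb2 (lcomb (erefl 0) (-1) h)); ring.
have L_sum v : L v = \sum_k v 0 k * L (delta_mx 0 k).
  rewrite /L {1}[v]row_sum_delta linear_sum form3_sum; apply: eq_bigr => k _.
  by rewrite linearZ /= form3Z.
have Lij : L (delta_mx 0 j) = L (delta_mx 0 i).
  apply/eqP; rewrite eq_sym -subr_eq0 /L -form3N -form3D -raddfB /=.
  by rewrite form_root_coroot.
have Lkl k l : k != i -> k != j -> l != i -> l != j ->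
    L (delta_mx 0 k) = L (delta_mx 0 l).
  move=> nki nkj nli nlj; case: (eqVneq k l) => [->//|nkl].
  (* E_kl commutes with h_ij, E_ji and E_ij, so only its bracket with E_lk survives, which is the
     coroot h_kl. *)
  have := inv (delta_mx k l) (diag_mx (coroot i j)) (delta_mx j i) (delta_mx l k)
    (delta_mx i j).
  rewrite mxcomm_root mxcomm_delta_diag !mxcomm_delta !coroot_out //.
  rewrite (negbTE nli) (negbTE nlj) ![_ == k]eq_sym (negbTE nki) (negbTE nkj).
  rewrite subrr !scale0r subrr !formE !add0r addr0 [diag_mx (coroot k l)]raddfB /=.
  by rewrite form3D form3N => /eqP; rewrite subr_eq0 => /eqP.
(* Without a third index the default 0 is harmless: the remaining sum is empty. *)
pose m := if [pick k | (k != i) && (k != j)] is Some k then L (delta_mx 0 k) else 0.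
have Lm k : k != i -> k != j -> L (delta_mx 0 k) = m.
  rewrite /m => nki nkj; case: pickP => [l /andP[nli nlj]|/(_ k)]; first exact: Lkl.
  by rewrite nki nkj.
exists (L (delta_mx 0 i) - m) => v v0.
have sum2 F : \sum_k F k = F i + (F j + \sum_(k | (k != i) && (k != j)) F k) :> K.
  by rewrite (bigD1 i) // (bigD1 j) // eq_sym.
rewrite LE L_sum sum2 Lij (eq_bigr (fun k => v 0 k * m)) => [|k /andP[nki nkj]]; last first.
  by rewrite Lm.
move: v0; rewrite -mulr_suml sum2; set S := \sum_(k | _) _ => v0.
have -> : S = - v 0 i - v 0 j by rewrite -[RHS]addr0 -v0; ring.
by ring.
Qed.

(** For n at least 3, a third index links the constants of different pairs. For n at most 2,
    tracelessness gives v_j = -v_i, so the values are zero whatever the constants. *)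
Lemma form_root_value : exists t, forall i j v, i != j -> \sum_k v 0 k = 0 ->
  T (delta_mx i j) (delta_mx j i) (diag_mx v) (diag_mx v)
  = t * (v 0 j ^+ 2 - v 0 i ^+ 2).
Proof.
have /fin_all_exists[kap0 kapP0] (p : 'I_n * 'I_n) : exists t, p.1 != p.2 ->
    forall v, \sum_k v 0 k = 0 ->
    T (delta_mx p.1 p.2) (delta_mx p.2 p.1) (diag_mx v) (diag_mx v)
    = t * (v 0 p.2 ^+ 2 - v 0 p.1 ^+ 2).
  case: (eqVneq p.1 p.2) => [_|/form_root_pair[t tP]]; first by exists 0.
  by exists t.
pose kap i j := kap0 (i, j).
have kapP i j : i != j -> forall v, \sum_k v 0 k = 0 ->
    T (delta_mx i j) (delta_mx j i) (diag_mx v) (diag_mx v)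
    = kap i j * (v 0 j ^+ 2 - v 0 i ^+ 2) := kapP0 (i, j).
have third i j : i != j -> (2 < n)%N -> exists2 k, k != i & k != j.
  move=> nij n2; have: (0 < #|~: [set i; j]|)%N.
    by rewrite cardsCs finset.setCK card_ord cards2 nij subn_gt0.
  by case/card_gt0P => k; rewrite !inE negb_or => /andP[]; exists k.
have tri i j k : i != j -> k != i -> k != j -> kap i k = kap i j /\ kap j i = kap i j.
  move=> nij nki nkj.
  (* v_j = v_k makes v commute with E_jk, and v_i^2 differs from v_j^2, so the constants can be
     compared. *)
  pose v : 'rV[K]_n := delta_mx 0 j + delta_mx 0 k - 2 *: delta_mx 0 i.
  have v0 : \sum_l v 0 l = 0.
    rewrite (eq_bigr (fun l => (delta_mx 0 j : 'rV[K]_n) 0 l + (delta_mx 0 k : 'rV[K]_n) 0 l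
       - 2 * (delta_mx 0 i : 'rV[K]_n) 0 l)); last by move=> l _; rewrite !mxE.
    by rewrite sumrB big_split -mulr_sumr /= !sum_delta_row; ring.
  have vi : v 0 i = -2 by rewrite !mxE !eqxx [i == k]eq_sym (negbTE nki) (negbTE nij) /=; ring.
  have vj : v 0 j = 1.
    by rewrite !mxE !eqxx [j == i]eq_sym (negbTE nij) [j == k]eq_sym (negbTE nkj) /=; ring.
  have vk : v 0 k = 1 by rewrite !mxE !eqxx (negbTE nki) (negbTE nkj) /=; ring.
  have nik : i != k by rewrite eq_sym.
  have nji : j != i by rewrite eq_sym.
  have hij := kapP i j nij v v0; have hji := kapP j i nji v v0.
  have hik := kapP i k nik v v0.
  have := inv (delta_mx j k) (delta_mx i j) (delta_mx k i) (diag_mx v) (diag_mx v).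
  rewrite !mxcomm_delta_diag !mxcomm_delta vj vk subrr !eqxx (negbTE nki) (negbTE nij).
  rewrite !scale0r !scale1r sub0r subr0 !formE !addr0 hij hik vi vj vk => h.
  rewrite alt hij vi vj in hji.
  split; apply/eqP; rewrite -subr_eq0; apply/eqP.
    by apply: (lcomb2 (lcomb (erefl 0) (2 / 3) h)); field.
  move/eqP: hji; rewrite -subr_eq0 => /eqP hji.
  by apply: (lcomb2 (lcomb (erefl 0) (- (2 / 3)) hji)); field.
have [n2|n2] := ltnP 2 n; last first.
  exists 0 => i j v nij v0; rewrite mul0r kapP //.
  suff /eqP : v 0 j + v 0 i = 0 by rewrite addr_eq0 => /eqP ->; rewrite sqrrN subrr mulr0.
  move: v0; rewrite (bigD1 i) // (bigD1 j) /=; last by rewrite eq_sym.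
  rewrite big_pred0 ?addr0 1?addrC // => k; apply: contraTF n2 => /andP[nki nkj].
  rewrite -ltnNge -[X in (_ < X)%N]card_ord.
  have /card_uniqP/= <- : uniq [:: i; j; k].
    by rewrite /= !inE negb_or nij [i == k]eq_sym nki [j == k]eq_sym nkj.
  exact: max_card.
have n1 : (1 < n)%N := ltnW n2; have n0 : (0 < n)%N := ltnW n1.
pose o := Ordinal n0; pose u := Ordinal n1.
have row i j k : i != j -> i != k -> kap i j = kap i k.
  move=> nij nik; case: (eqVneq j k) => [->//|njk].
  by have [] := tri i k j nik; rewrite // eq_sym.
have kapC i j : i != j -> kap j i = kap i j.
  by move=> nij; have [k nki nkj] := third i j nij n2; have [] := tri i j k nij nki nkj.
exists (kap o u) => i j v nij v0; rewrite kapP //; congr (_ * _).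
(* Change the second index to 0, transpose, then change the second index to 1. *)
case: (eqVneq i o) nij => [-> noj|nio nij]; first exact: row.
rewrite (row i j o) // -kapC //; apply: row => //.
by rewrite eq_sym.
Qed.

(** The torus weights of the two units do not cancel while v has weight 0; the action of E_ii or
    E_jj detects the nonzero total weight. *)
Lemma form_weight i j k l v : i != j -> (k != j) || (l != i) ->
  T (delta_mx i j) (delta_mx k l) (diag_mx v) (diag_mx v) = 0.
Proof.
move=> nij nkl.
have wt p := inv (diag_mx (delta_mx 0 p)) (delta_mx i j) (delta_mx k l)
  (diag_mx v) (diag_mx v).
move: (wt i) (wt j); rewrite !mxcomm_diag_delta !mxcomm_diag !formE !addr0 -!mulrDl !mxE.
rewrite !eqxx (negbTE nij) [j == i]eq_sym (negbTE nij).
rewrite !andbT !andbF !andTb subr0 sub0r.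
move=> /eqP h1 /eqP h2; apply/eqP; move: h1 h2; rewrite !mulf_eq0.
case: (eqVneq l i) nkl => [->|nli] /=; last first.
  by move=> _ /orP[|//]; rewrite subr0 -natrD pnatr_eq0.
rewrite orbF (negbTE nij) => nkj _ /orP[|//].
by rewrite (negbTE nkj) subr0 addr0 oppr_eq0 oner_eq0.
Qed.

End FormTheory.

(** * Comparison with the trace form *)

Lemma mxcommD A B B' : mxcomm A (B + B') = mxcomm A B + mxcomm A B'.
Proof. by rewrite /mxcomm mulmxDr mulmxDl opprD addrACA. Qed.

Lemma mxcommN A B : mxcomm A (- B) = - mxcomm A B.
Proof. by rewrite /mxcomm mulmxN mulNmx opprB opprK addrC. Qed.

Lemma mxcommM A B B' : mxcomm A (B *m B') = mxcomm A B *m B' + B *m mxcomm A B'.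
Proof. by rewrite /mxcomm mulmxBl mulmxBr !mulmxA addrA subrK. Qed.

Lemma mxcomm_Jacobi A B B' :
  mxcomm A (mxcomm B B') = mxcomm (mxcomm A B) B' + mxcomm B (mxcomm A B').
Proof.
rewrite {2}/mxcomm mxcommD mxcommN !mxcommM opprD [X in _ = X + _]/mxcomm.
rewrite [X in _ = _ + X]/mxcomm -!addrA; congr (_ + _).
by rewrite [RHS]addrC -!addrA; congr (_ + _); rewrite addrC.
Qed.

Lemma mxtrace_comm A B : \tr (mxcomm A B) = 0.
Proof. by rewrite raddfB /= mxtrace_mulC subrr. Qed.

(** The Lie bracket followed by the invariant symmetric cubic form tr(x(yz + zy)); at y = z it is 2
    tr([a, b] y^2). *)
Definition trace_form a b y z : K := \tr (mxcomm a b *m (y *m z + z *m y)).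

(** By Jacobi and the Leibniz rule, the four terms of invariance add up to the trace of one
    commutator with c. *)
Lemma trace_form_invariant : invariant_form trace_form.
Proof.
rewrite /trace_form; split.
- move=> b y z t a a'; rewrite -mxtraceZ -raddfD /= scalemxAl -mulmxDl.
  congr (\tr (_ *m _)); rewrite /mxcomm mulmxDl mulmxDr -scalemxAl -scalemxAr scalerBr opprD.
  by rewrite [in RHS]addrACA.
- move=> a b z t y y'; rewrite -mxtraceZ -raddfD /= scalemxAr -mulmxDr.
  by congr (\tr (_ *m _)); rewrite mulmxDl mulmxDr -scalemxAl -scalemxAr scalerDr [in RHS]addrACA.
- by move=> a b y z; rewrite -raddfN /= -mulNmx opprB.
- by move=> a b y z; rewrite addrC.
move=> c a b y z; rewrite -!raddfD /=.
rewrite -mulmxDl -mxcomm_Jacobi -addrA -mulmxDr.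
rewrite (_ : _ + _ + _ = mxcomm c (y *m z + z *m y)).
  by rewrite -mxcommM mxtrace_comm.
by rewrite mxcommD !mxcommM addrACA; congr (_ + _); rewrite addrC.
Qed.

(** If a commutes with y it commutes with y^2, and cyclicity of the trace cancels the two terms of
    tr([a, b] y^2). *)
Lemma trace_formE a b y : mxcomm a y = 0 -> trace_form a b y y = 0.
Proof.
move/eqP; rewrite subr_eq0 => /eqP ay.
rewrite /trace_form -mulr2n -scaler_nat -scalemxAr mxtraceZ mulmxBl raddfB /=.
have ayy : a *m (y *m y) = y *m y *m a by rewrite mulmxA ay -mulmxA ay mulmxA.
by rewrite -!mulmxA ayy mxtrace_mulC -!mulmxA subrr mulr0.
Qed.

(* S^2 g is generated as a g-module by S^2 of the diagonal subalgebra. *)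
Lemma form_eq0 T (HT : invariant_form T) :
  (forall a b v, \sum_k v 0 k = 0 -> T a b (diag_mx v) (diag_mx v) = 0) ->
  forall a b y z, \tr y = 0 -> \tr z = 0 -> T a b y z = 0.
Proof.
move=> T0.
have lcomb2 (x u : K) : u = 0 -> x *+ 2 = u -> x = 0.
  by move=> -> /eqP; rewrite mulrn_eq0 /= => /eqP.
have diag2 a b v w : \sum_k v 0 k = 0 -> \sum_k w 0 k = 0 ->
    T a b (diag_mx v) (diag_mx w) = 0.
  move=> v0 w0; have := T0 a b (v + w); rewrite raddfD /=.
  rewrite (form3D HT) !(form4D HT) !T0 // add0r addr0.
  rewrite [T a b (diag_mx w) _](form_sym HT) -mulr2n => h; apply: lcomb2 (h _) erefl.
  by under eq_bigr do rewrite mxE; rewrite big_split /= v0 w0 addr0.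
(* The terms in which E_ij acts on a or b vanish, their last two arguments being diagonal. Taking w
   = h_ij settles v_i = v_j, and w = v settles the other case. *)
have off a b i j v : i != j -> \sum_k v 0 k = 0 -> T a b (delta_mx i j) (diag_mx v) = 0.
  move=> nij v0.
  have inv w : \sum_k w 0 k = 0 ->
      (w 0 j - w 0 i) * T a b (delta_mx i j) (diag_mx v)
      + (v 0 j - v 0 i) * T a b (delta_mx i j) (diag_mx w) = 0.
    move=> w0; have := form_inv HT (delta_mx i j) a b (diag_mx w) (diag_mx v).
    rewrite !diag2 // !add0r !mxcomm_delta_diag (form3Z HT) (form4Z HT).
    by rewrite [T a b (diag_mx w) _](form_sym HT).
  have h := inv _ (sum_coroot i j); move: h; rewrite coroot_l // coroot_r //.
  have [->|nv _] := eqVneq (v 0 j) (v 0 i).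
    rewrite subrr mul0r addr0 => /eqP; rewrite mulf_eq0 -opprD oppr_eq0 -mulr2n pnatr_eq0.
    by move=> /eqP.
  have /eqP := inv v v0; rewrite -mulr2n mulrn_eq0 /= mulf_eq0 subr_eq0.
  by rewrite (negbTE nv) => /eqP.
have off2 a b i j k l : i != j -> k != l -> T a b (delta_mx i j) (delta_mx k l) = 0.
  move=> nij nkl.
  (* E_kl is -1/2 [E_kl, h_kl], and [E_kl, E_ij] paired with h_kl falls under the preceding
     cases. *)
  have := form_inv HT (delta_mx k l) a b (delta_mx i j) (diag_mx (coroot k l)).
  rewrite !off ?sum_coroot // !add0r mxcomm_delta_diag coroot_l // coroot_r // (form4Z HT).
  have -> : T a b (mxcomm (delta_mx k l) (delta_mx i j)) (diag_mx (coroot k l)) = 0.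
    rewrite mxcomm_delta; case: (eqVneq l i) nij => [<-|nli]; case: (eqVneq j k) => [->|njk] nij.
    - rewrite !scale1r !delta_diag -raddfB; apply: diag2; exact: sum_coroot.
    - by rewrite scale1r scale0r subr0 off ?sum_coroot // eq_sym.
    - by rewrite scale1r scale0r sub0r (form3N HT) off ?oppr0 ?sum_coroot // eq_sym.
    - by rewrite !scale0r subr0 (form30 HT).
  by rewrite add0r => /eqP; rewrite mulf_eq0 -opprD oppr_eq0 -mulr2n pnatr_eq0 /= => /eqP.
have dec y : y = \sum_i \sum_(j | j != i) y i j *: delta_mx i j + diag_mx (\row_i y i i).
  rewrite {1}[y]matrix_sum_delta diag_mx_sum_delta -big_split; apply: eq_bigr => i _.
  by rewrite (bigD1 i) //= addrC mxE.
move=> a b y z y0 z0; rewrite [y]dec [z]dec (form3D HT) !(form4D HT).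
rewrite diag2; last 2 first.
- by under eq_bigr do rewrite mxE.
- by under eq_bigr do rewrite mxE.
have offs u v : \sum_k v 0 k = 0 ->
   T a b (\sum_i \sum_(j | j != i) u i j *: delta_mx i j) (diag_mx v) = 0.
  move=> v0; rewrite (form3_sum HT) big1 // => i _; rewrite (form3_sum HT) big1 // => j nji.
  by rewrite (form3Z HT) off ?mulr0 // eq_sym.
rewrite offs; last by under eq_bigr do rewrite mxE.
rewrite [T a b (diag_mx _) _](form_sym HT) offs ?addr0; last by under eq_bigr do rewrite mxE.
rewrite (form3_sum HT) big1 // => i _; rewrite (form3_sum HT) big1 // => j nji.
rewrite (form4_sum HT) big1 // => k _; rewrite (form4_sum HT) big1 // => l nlk.
by rewrite (form3Z HT) (form4Z HT) off2 ?mulr0 // eq_sym.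
Qed.

Lemma form_comm_eq0 T (HT : invariant_form T)
    (T1 : forall b y z, T 1%:M b y z = 0) a b y :
  \tr y = 0 -> mxcomm a y = 0 -> T a b y y = 0.
Proof.
move=> y0 ay; have [t tP] := form_root_value HT.
(* On (E_ij, E_ji, v, v) [trace_form] is 2 (v_i^2 - v_j^2), so the coefficient [t / 2] cancels the
   value given by [form_root_value]. *)
pose T' a b y z := T a b y z + t / 2 * trace_form a b y z.
have HT' : invariant_form T'.
  have [h1 h2 h3 h4 h5] := HT; have [g1 g2 g3 g4 g5] := trace_form_invariant.
  rewrite /T'; split=> [*|*|*|*|c a' b' y' z'].
  - by rewrite h1 g1; ring.
  - by rewrite h2 g2; ring.
  - by rewrite h3 g3; ring.
  - by rewrite h4 g4.
  have E p q : p = 0 -> q = 0 -> p + t / 2 * q = 0 by move=> -> ->; rewrite mulr0 addr0.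
  by apply: etrans (E _ _ (h5 c a' b' y' z') (g5 c a' b' y' z')); ring.
suff : T' a b y y = 0 by rewrite /T' trace_formE // mulr0 addr0.
apply: (form_eq0 HT') => // {y y0 ay a b} a b v v0.
rewrite [a]matrix_sum_delta (form1_sum HT') big1 // => i _.
rewrite (form1_sum HT') big1 // => j _; rewrite (form1Z HT').
rewrite [b]matrix_sum_delta (form2_sum HT') big1 ?mulr0 // => k _.
rewrite (form2_sum HT') big1 // => l _; rewrite (form2Z HT').
suff -> : T' (delta_mx i j) (delta_mx k l) (diag_mx v) (diag_mx v) = 0 by rewrite mulr0.
have [->|nij] := eqVneq i j.
  have [->|nkl] := eqVneq k l.
    by rewrite !delta_diag /T' form_diag_mx // /trace_form mxcomm_diag mul0mx mxtrace0 mulr0 addr0.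
  rewrite (form_alt HT') (form_weight HT') ?oppr0 //.
  by case: (eqVneq j l) => //= ->; rewrite eq_sym.
have [nji|] := boolP ((k != j) || (l != i)); first exact: (form_weight HT').
rewrite negb_or !negbK => /andP[/eqP-> /eqP->].
rewrite /T' tP // /trace_form mxcomm_root !mulmx_diag -raddfD /= mulmx_diag mxtrace_diag.
rewrite (bigD1 i) // (bigD1 j) /=; last by rewrite eq_sym.
rewrite big1 => [|p /andP[npi npj]]; last by rewrite mxE coroot_out ?mul0r.
by rewrite mxE coroot_l // mxE coroot_r // !mxE; field.
Qed.

End InvariantForms.

(** * The polarization of an equivariant map *)

Section Homogeneous.
Variables (K : comNzRingType) (m : nat).
Implicit Types (F : mpoly m K) (v : 'I_m -> K) (d : nat).

Lemma mderiv_homog d i F :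
  F \is ishomog1 d.+1 mdeg -> mderiv i F \is ishomog1 d mdeg.
Proof.
move=> /dhomogP Fd; apply/dhomogP => k; rewrite mcoeff_msupp mcoeff_deriv => nz.
have kF : mnm_add k (mnm1 i) \in msupp F.
  by rewrite mcoeff_msupp; apply: contraNneq nz => ->; rewrite mul0rn.
by apply/eqP; rewrite -eqSS -(Fd _ kF) /= mdegD mdeg1 addn1.
Qed.

Lemma meval_homog0 v w F : F \is ishomog1 0 mdeg -> meval v F = meval w F.
Proof.
move=> /dhomogP F0; rewrite !mevalE; apply: eq_big_seq => k /F0/eqP.
rewrite mdeg_eq0 => /eqP ->; congr (_ * _); apply: eq_bigr => i _.
by rewrite mnm0E !expr0.
Qed.

Lemma meval_Euler d v F : F \is ishomog1 d mdeg ->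
  \sum_i v i * meval v (mderiv i F) = d%:R * meval v F.
Proof.
move=> /dhomogP Fd.
have dF i : mderiv i F = \sum_(k <- msupp F) mcoeff k F *: mderiv i (mpolyX K k).
  rewrite {1}(mpolyE F) linear_sum; apply: eq_bigr => k _; exact: linearZ.
have eF : meval v F = \sum_(k <- msupp F) mcoeff k F * meval v (mpolyX K k).
  rewrite {1}(mpolyE F) raddf_sum; apply: eq_bigr => k _; exact: mevalZ.
under eq_bigr do rewrite dF raddf_sum mulr_sumr /=.
rewrite exchange_big /= eF mulr_sumr; apply: eq_big_seq => k kF.
under eq_bigr do rewrite mevalZ mulrCA.
rewrite -mulr_sumr mulrCA; congr (_ * _).
rewrite -(Fd _ kF) /= mdegE natr_sum mulr_suml; apply: eq_bigr => i _.
rewrite mderivX mevalZ mulrCA.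
(* If k_i = 0 the subtraction in the exponent is truncated, but the coefficient k_i vanishes. *)
have [->|ki] := eqVneq (k i) 0%N; first by rewrite !mul0r.
congr (_ * _); have := lep1mP i k; rewrite ki => /submK {2}<-.
by rewrite mpolyXD mevalM mevalXU [in RHS]mulrC.
Qed.

(** The second derivatives of a quadratic polynomial are constants, which evaluation at 0 turns into
    scalars. *)
Definition hessian F i j : K := meval (fun=> 0) (mderiv j (mderiv i F)).

Lemma hessianC F i j : hessian F i j = hessian F j i.
Proof. by rewrite /hessian mderiv_comm. Qed.

Lemma hessian_linear i j : linear (fun F => hessian F i j : K^o).
Proof. by move=> t F G; rewrite /hessian !linearP. Qed.

Lemma meval_mderiv_hessian v F i : F \is ishomog1 2 mdeg ->
  meval v (mderiv i F) = \sum_j hessian F i j * v j.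
Proof.
move=> F2; have F1 := mderiv_homog i F2.
rewrite -[LHS]mul1r -(meval_Euler v F1); apply: eq_bigr => j _.
rewrite mulrC; congr (_ * _); apply: meval_homog0; exact: mderiv_homog.
Qed.

Lemma meval_hessian v F : F \is ishomog1 2 mdeg ->
  \sum_i \sum_j hessian F i j * v i * v j = 2 * meval v F.
Proof.
move=> F2; rewrite -(meval_Euler v F2); apply: eq_bigr => i _.
rewrite meval_mderiv_hessian // mulr_sumr; apply: eq_bigr => j _.
by rewrite mulrCA mulrA.
Qed.

End Homogeneous.

(** * From equivariant maps to invariant forms *)

Section FormOfMap.
Variables (K : numFieldType) (n : nat).
Local Notation sl := (sl K n).
Local Notation Sg := (Sg K n).
Implicit Types (A B c y z : 'M[K]_n) (a b : sl).

(** The projection of gl_n onto sl_n along the scalar matrices, which lets forms on sl_n be tested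
    on matrix units. *)
Definition mxcenter A : 'M[K]_n := A - (\tr A / n%:R)%:M.

Lemma mxtrace_center A : \tr (mxcenter A) = 0.
Proof.
rewrite raddfB /= mxtrace_scalar; case: (posnP n) => [n0|n_gt0].
  have -> : \tr A = 0 by apply: big1 => -[i lt_i_n] _; exfalso; rewrite n0 in lt_i_n.
  by rewrite mul0r mul0rn subr0.
by rewrite -[X in _ - X]mulr_natr divfK ?subrr // pnatr_eq0 -lt0n.
Qed.

Lemma mxcenter1 : mxcenter 1%:M = 0.
Proof.
apply/matrixP => i j; rewrite /mxcenter mxtrace1 divff ?subrr //.
by rewrite pnatr_eq0 -lt0n (leq_ltn_trans (leq0n i)).
Qed.

Lemma mxcenter_id A : \tr A = 0 -> mxcenter A = A.
Proof. by move=> A0; rewrite /mxcenter A0 mul0r raddf0 subr0. Qed.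

Lemma mxcenter_linear : linear mxcenter.
Proof.
move=> t A B; rewrite /mxcenter linearP /= mulrDl -mulrA raddfD /= -scale_scalar_mx.
by rewrite scalerBr opprD addrACA.
Qed.
HB.instance Definition _ := GRing.isLinear.Build K 'M[K]_n 'M[K]_n _ mxcenter mxcenter_linear.

Definition to_sl A : sl := vsproj (slv K n) (mxcenter A).

Lemma val_to_sl A : vsval (to_sl A) = mxcenter A.
Proof. by rewrite vsprojK // mem_slv mxtrace_center. Qed.

Lemma sl_trace a : \tr (vsval a) = 0.
Proof. by apply/eqP; rewrite -mem_slv subvsP. Qed.

Lemma to_sl_val a : to_sl (vsval a) = a.
Proof. by rewrite /to_sl mxcenter_id ?sl_trace // vsvalK. Qed.

Lemma to_sl1 : to_sl 1%:M = 0.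
Proof. by rewrite /to_sl mxcenter1 raddf0. Qed.

Lemma to_sl_linear : linear to_sl.
Proof. by move=> t A B; rewrite /to_sl !linearP. Qed.
HB.instance Definition _ := GRing.isLinear.Build K 'M[K]_n sl _ to_sl to_sl_linear.

Lemma mxcomm_centerl A B : mxcomm (mxcenter A) B = mxcomm A B.
Proof.
rewrite /mxcenter /mxcomm mulmxBl mulmxBr [_ *m _%:M]scalar_mxC.
by rewrite opprB addrA subrK.
Qed.

Lemma mxcomm_centerr A B : mxcomm A (mxcenter B) = mxcomm A B.
Proof. by rewrite -[LHS]opprB -/(mxcomm _ _) mxcomm_centerl opprB. Qed.

(** Scalars being central, the projection is a Lie algebra morphism; this carries the equivariance
    of [phi] over to all matrices. *)
Lemma lieb_to_sl A B : lieb (to_sl A) (to_sl B) = to_sl (mxcomm A B).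
Proof.
apply: subvs_inj; rewrite val_lieb !val_to_sl -/(mxcomm _ _) mxcomm_centerl mxcomm_centerr.
by rewrite mxcenter_id // mxtrace_comm.
Qed.

Definition trace_with y a : K^o := \tr (y *m vsval a).

Lemma trace_with_linear y : linear (trace_with y).
Proof. by move=> t a b; rewrite /trace_with !linearP. Qed.
HB.instance Definition _ y :=
  GRing.isLinear.Build K sl K^o _ (trace_with y) (trace_with_linear y).

Definition trace_dual y : sl_dual K n := linfun (trace_with y).

Lemma trace_dualE y a : trace_dual y a = \tr (y *m vsval a).
Proof. by rewrite lfunE. Qed.

Lemma trace_dual_surj (x : sl_dual K n) : exists2 y, \tr y = 0 & x = trace_dual y.
Proof.
(* The indices are transposed because tr(y a) pairs y_ij with a_ji. The trace of y is the value of
   [x] at the projection of the identity, which is 0. *)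
exists (\matrix_(i, j) x (to_sl (delta_mx j i))).
  rewrite /mxtrace; under eq_bigr do rewrite mxE.
  by rewrite -!linear_sum -mx1_sum_delta /= to_sl1 linear0.
apply/lfunP => a; rewrite trace_dualE -[in LHS](to_sl_val a).
rewrite [in LHS](matrix_sum_delta (vsval a)) exchange_big !linear_sum.
apply: eq_bigr => j _; rewrite mxE !linear_sum; apply: eq_bigr => i _.
by rewrite !linearZ mxE mulrC.
Qed.

Lemma trace_dual_lieb y u a :
  trace_dual y (lieb u a) = - trace_dual (mxcomm (vsval u) y) a.
Proof.
rewrite !trace_dualE val_lieb /mxcomm mulmxBr mulmxBl !linearB /= !mulmxA opprK [RHS]addrC.
by rewrite [\tr (_ *m vsval u)]mxtrace_mulC mulmxA.
Qed.

Lemma sym_eval_hessian (x : sl_dual K n) (F : Sg) : F \is ishomog1 2 mdeg ->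
  2 * sym_eval x F = \sum_i \sum_j hessian F i j * x (slb K n)`_i * x (slb K n)`_j.
Proof. by move=> F2; rewrite -meval_hessian. Qed.

Lemma sym_eval_ad (x : sl_dual K n) u (F : Sg) : F \is ishomog1 2 mdeg ->
  sym_eval x (sym_ad u F) =
  \sum_i \sum_j hessian F i j * x (lieb u (slb K n)`_i) * x (slb K n)`_j.
Proof.
move=> F2; rewrite /sym_eval /sym_ad raddf_sum; apply: eq_bigr => i _.
rewrite /= mevalM -/(sym_eval x _) sym_eval_inj meval_mderiv_hessian //.
by rewrite mulr_sumr; apply: eq_bigr => j _; rewrite mulrCA mulrA.
Qed.

Variable phi : sl -> sl -> Sg.
Hypothesis phi_inv : invariant_wedge2_S2 phi.

(** The matrices y, z stand for points of the dual through the trace form. At y = z this is twice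
    the value there of the polynomial given by [phi], by [sym_eval_hessian]. *)
Definition polar_form A B y z : K := \sum_i \sum_j
  hessian (phi (to_sl A) (to_sl B)) i j
  * trace_dual y (slb K n)`_i * trace_dual z (slb K n)`_j.

Lemma trace_dual_linear a : linear (fun y => trace_dual y a : K^o).
Proof. by move=> t y z; rewrite !trace_dualE mulmxDl -scalemxAl linearP. Qed.

Lemma polar_form_invariant : invariant_form polar_form.
Proof.
have [[phi1 phi2] phi_alt phi_homog phi_ad] := phi_inv.
have lin1 B y z t A A' :
    polar_form (t *: A + A') B y z = t * polar_form A B y z + polar_form A' B y z.
  rewrite /polar_form mulr_sumr -big_split; apply: eq_bigr => i _.
  rewrite mulr_sumr -big_split; apply: eq_bigr => j _ /=.
  rewrite linearP phi1 hessian_linear /=.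
  by rewrite -[_ *: hessian _ _ _]/(t * hessian _ _ _); ring.
have lin2 A y z B B' :
    polar_form A (B + B') y z = polar_form A B y z + polar_form A B' y z.
  rewrite /polar_form -big_split; apply: eq_bigr => i _.
  rewrite -big_split; apply: eq_bigr => j _ /=.
  rewrite -{1}[B]scale1r linearP phi2 hessian_linear !scale1r /=.
  by ring.
have lin3 A B z t y y' :
    polar_form A B (t *: y + y') z = t * polar_form A B y z + polar_form A B y' z.
  rewrite /polar_form mulr_sumr -big_split; apply: eq_bigr => i _.
  rewrite mulr_sumr -big_split; apply: eq_bigr => j _ /=.
  rewrite trace_dual_linear /=.
  by rewrite -[_ *: trace_dual _ _]/(t * trace_dual _ _); ring.
have sym A B y z : polar_form A B z y = polar_form A B y z.
  rewrite /polar_form exchange_big; apply: eq_bigr => i _; apply: eq_bigr => j _.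
  by rewrite hessianC mulrAC.
have diag A y z : polar_form A A y z = 0.
  rewrite /polar_form phi_alt big1 // => i _; rewrite big1 // => j _.
  by rewrite /hessian !linear0 !mul0r.
have inv C A B y : polar_form (mxcomm C A) B y y + polar_form A (mxcomm C B) y y
    + 2 * polar_form A B (mxcomm C y) y = 0.
  have evalP A' B' : polar_form A' B' y y =
      2 * sym_eval (trace_dual y) (phi (to_sl A') (to_sl B')).
    by rewrite sym_eval_hessian.
  rewrite !evalP -!lieb_to_sl -!mulrDr.
  (* Equivariance turns the sum into [sym_ad] of the polynomial. This acts on one slot of the
     Hessian, and [trace_dual_lieb] moves it to y with a minus sign. *)
  have -> : sym_eval (trace_dual y) (phi (lieb (to_sl C) (to_sl A)) (to_sl B))
      + sym_eval (trace_dual y) (phi (to_sl A) (lieb (to_sl C) (to_sl B)))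
      = - polar_form A B (mxcomm C y) y.
    rewrite -mevalD -phi_ad -/(sym_eval _ _) sym_eval_ad // /polar_form -sumrN.
    apply: eq_bigr => i _; rewrite -sumrN; apply: eq_bigr => j _.
    by rewrite trace_dual_lieb val_to_sl mxcomm_centerl; ring.
  by rewrite addNr mulr0.
exact: quadratic_invariant_form.
Qed.

Lemma polar_form1 B y z : polar_form 1%:M B y z = 0.
Proof.
have [[phi1 _] _ _ _] := phi_inv.
rewrite /polar_form to_sl1 big1 // => i _; rewrite big1 // => j _.
have -> : phi 0 (to_sl B) = 0.
  by have := phi1 (to_sl B) (-1) 0 0; rewrite scaler0 addr0 scaleN1r addNr.
by rewrite /hessian !linear0 !mul0r.
Qed.

Lemma eval_comm_eq0 y a b : \tr y = 0 -> mxcomm (vsval a) y = 0 ->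
  sym_eval (trace_dual y) (phi a b) = 0.
Proof.
move=> y0 ay; have [_ _ phi_homog _] := phi_inv.
have := form_comm_eq0 polar_form_invariant polar_form1 (vsval b) y0 ay.
rewrite /polar_form !to_sl_val -sym_eval_hessian // => /eqP.
by rewrite mulf_eq0 pnatr_eq0 => /eqP.
Qed.

End FormOfMap.

(** * Tangent vectors and bivectors *)

Section SquareZero.
Variables (K : numFieldType) (n : nat).
Implicit Types (c y : 'M[K]_n).

Lemma invmx_unique (P Q : 'M[K]_n) : P *m Q = 1%:M -> invmx P = Q.
Proof.
move=> PQ; have [uP _] := mulmx1_unit PQ.
by rewrite -[LHS]mulmx1 -PQ mulKmx.
Qed.

Lemma square0_mul t c : c *m c = 0 -> (1%:M + t *: c) *m (1%:M - t *: c) = 1%:M.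
Proof.
move=> c0; rewrite mulmxDl mul1mx mulmxBr mulmx1 -scalemxAr -scalemxAl c0.
by rewrite !scaler0 subr0 subrK.
Qed.

(** Over K[X], det(1 + Xc) has the inverse det(1 - Xc), so it is a constant polynomial, equal to its
    value 1 at X = 0. *)
Lemma det_square0 t c : c *m c = 0 -> \det (1%:M + t *: c) = 1.
Proof.
move=> c0; pose C := map_mx polyC c; pose p := \det (1%:M + 'X *: C).
have hp u : p.[u] = \det (1%:M + u *: c).
  rewrite /p -horner_evalE -det_map_mx; congr (\det _).
  apply/matrixP => i j; rewrite !mxE /= horner_evalE hornerD hornerM hornerX hornerC.
  by rewrite hornerMn hornerC.
have : p \is a GRing.unit.
  apply/unitrP; exists (\det (1%:M - 'X *: C)).
  suff E : (1%:M + 'X *: C) *m (1%:M - 'X *: C) = 1%:M.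
    by rewrite mulrC -det_mulmx E det1.
  have C0 : C *m C = 0 by rewrite -map_mxM c0 map_mx0.
  rewrite mulmxDl mul1mx mulmxBr mulmx1 -scalemxAr -scalemxAl C0.
  by rewrite !scaler0 subr0 subrK.
rewrite poly_unitE => /andP[/size_poly1P[d _ pd] _].
by rewrite -hp pd hornerC -[RHS](det1 K n) -[1%:M]addr0 -(scale0r c) -hp pd hornerC.
Qed.

Lemma coadjM (P Q : 'M[K]_n) (x : sl_dual K n) : P \in unitmx -> Q \in unitmx ->
  coadj P (coadj Q x) = coadj (P *m Q) x.
Proof.
move=> uP uQ; apply/lfunP => a; rewrite !comp_lfunE !lfunE; congr (x _).
apply: subvs_inj; rewrite !val_Ad ?unitmx_inv ?unitmx_mul ?uP // !invmxK.
have -> : invmx (P *m Q) = invmx Q *m invmx P.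
  by apply: invmx_unique; rewrite mulmxA mulmxK // mulmxV.
by rewrite !mulmxA.
Qed.

(** The inverse of 1 + tc is 1 - tc, so the curve is quadratic in t. Both coefficients [a, c] and c
    a c are traceless, the latter because c^2 = 0. *)
Lemma coadj_square0 t c (x : sl_dual K n) a : c *m c = 0 ->
  coadj (1%:M + t *: c) x a =
  x a + t * x (to_sl (mxcomm (vsval a) c)) - t ^+ 2 * x (to_sl (c *m vsval a *m c)).
Proof.
move=> c0; rewrite comp_lfunE lfunE /= (invmx_unique (square0_mul t c0)).
have E : (1%:M - t *: c) *m (1%:M + t *: c) = 1%:M.
  by have := square0_mul (- t) c0; rewrite !scaleNr opprK.
have valE p q s : vsval (a + t *: p - s *: q) = vsval a + t *: vsval p - s *: vsval q.
  by rewrite linearB linearD !linearZ.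
have -> : Ad (1%:M - t *: c) a =
    a + t *: to_sl (mxcomm (vsval a) c) - t ^+ 2 *: to_sl (c *m vsval a *m c).
  apply: subvs_inj; rewrite val_Ad; last by have [] := mulmx1_unit E.
  rewrite (invmx_unique E) valE !val_to_sl !mxcenter_id.
  - rewrite /mxcomm mulmxBl mul1mx mulmxDr mulmx1 mulmxBl -!scalemxAl -!scalemxAr.
    rewrite scalerA -expr2 scalerBr !addrA; congr (_ - _).
    by rewrite addrAC.
  - by rewrite mxtrace_mulC mulmxA c0 mul0mx mxtrace0.
  - exact: mxtrace_comm.
by rewrite linearB linearD !linearZ.
Qed.

Lemma tangent_coadj_orbit (x : sl_dual K n) c y : c *m c = 0 ->
  coadj_orbit x (trace_dual y) ->
  tangent (coadj_orbit x) (trace_dual y) (trace_dual (mxcomm c y)).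
Proof.
move=> c0 [P /= detP xP].
have uP : P \in unitmx by rewrite unitmxE detP unitr1.
have FK : Filter (nbhs (0 : K)) by exact: nbhs_filter.
exists (fun t : K^o => coadj (1%:M + t *: c) (trace_dual y)); split.
- by apply/lfunP => a; rewrite coadj_square0 // expr0n !mul0r addr0 subr0.
- apply: (filterE FK) => t; exists ((1%:M + t *: c) *m P).
    by rewrite /= det_mulmx det_square0 // detP mulr1.
  by rewrite -coadjM ?xP // unitmxE det_square0 // unitr1.
- apply: (filterE FK) => t a.
  under eq_fun do rewrite coadj_square0 //.
  by apply: derivableD; [apply: derivableD|]; done.
- move=> a; pose b := trace_dual y (to_sl (mxcomm (vsval a) c)) : K^o.
  pose d := trace_dual y (to_sl (c *m vsval a *m c)) : K^o.
  have -> : (fun s : K^o => coadj (1%:M + s *: c) (trace_dual y) a : K^o) =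
      (cst (trace_dual y a : K^o) + id * cst b - (id * id) * cst d)%R.
    by apply/funext => s; rewrite coadj_square0 // expr2.
  apply: is_derive_eq.
  rewrite !(scaler0, scale0r, addr0, add0r, subr0) [_%:A]mulr1 /b.
  (* The linear coefficient y([a, c]) is -y([c, a]), which [trace_dual_lieb] rewrites as the pairing
     of [c, y] with a. *)
  rewrite -[mxcomm _ c]opprB -/(mxcomm _ _) -[vsval a in LHS](mxcenter_id (sl_trace a)).
  rewrite mxcomm_centerr raddfN raddfN /= -lieb_to_sl trace_dual_lieb.
  by rewrite /cst /= opprK val_to_sl mxcomm_centerl to_sl_val.
Qed.

Lemma mxtrace_delta_mul i j (W : 'M[K]_n) : \tr (delta_mx i j *m W) = W j i.
Proof.
rewrite /mxtrace (bigD1 i) //= big1 ?addr0 => [|k nki].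
  rewrite mxE (bigD1 j) //= big1 ?addr0 => [|l nlj]; rewrite !mxE eqxx.
    by rewrite eqxx mul1r.
  by rewrite (negbTE nlj) mul0r.
by rewrite mxE big1 // => l _; rewrite mxE (negbTE nki) mul0r.
Qed.

(** Square-zero matrices spanning sl_n: the root vectors, and the rank-one matrices (e_i + e_j)(e_i
    - e_j)^T, which are the coroots up to root vectors. The value 0 at i = j keeps the index set a
    full product. *)
Definition square0_root (p : 'I_n * 'I_n * bool) : 'M[K]_n :=
  let: (i, j, diagonal) := p in
  if i == j then 0 else if diagonal
  then delta_mx i i - delta_mx i j + delta_mx j i - delta_mx j j
  else delta_mx i j.

Lemma square0_rootP p : square0_root p *m square0_root p = 0.
Proof.
case: p => [[i j] b] /=; case: (eqVneq i j) => [_|nij]; first by rewrite mul0mx.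
have nji : j == i = false by rewrite eq_sym (negbTE nij).
case: b; last by rewrite mul_delta_mx_0 // eq_sym.
rewrite !(mulmxDl, mulmxDr, mulNmx, mulmxN) !mul_delta_mx_cond !eqxx (negbTE nij) nji.
by apply/matrixP => p q; rewrite !mxE; ring.
Qed.

(** By cyclicity [c, y] is orthogonal to a spanning set of sl_n for the trace form, hence scalar,
    and its trace is zero. Thus the annihilator of the tangent vectors is the centralizer of y. *)
Lemma root_comm_eq0 y c :
  (forall p, \tr (mxcomm (square0_root p) y *m c) = 0) -> mxcomm c y = 0.
Proof.
move=> h; set W := mxcomm c y.
have hW p : \tr (square0_root p *m W) = 0.
  rewrite -[RHS]oppr0 -(h p) /W /mxcomm mulmxBr mulmxBl !linearB /= !mulmxA opprK.
  by rewrite addrC -[y *m _ *m c]mulmxA [\tr (y *m _)]mxtrace_mulC.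
have trW : \tr W = 0 by rewrite mxtrace_comm.
clearbody W; have off i j : i != j -> W j i = 0.
  by move=> nij; rewrite -(hW (i, j, false)) /= (negbTE nij) mxtrace_delta_mul.
have diag i j : W i i = W j j.
  have [->//|nij] := eqVneq i j.
  have := hW (i, j, true); rewrite /= (negbTE nij) !(mulmxDl, mulNmx) !linearD !linearN /=.
  rewrite !mxtrace_delta_mul (off i j) // (off j i) 1?eq_sym // subr0 addr0 => /eqP.
  by rewrite subr_eq0 => /eqP.
apply/matrixP => i j; rewrite [RHS]mxE; have [<-|nij] := eqVneq i j; last first.
  by rewrite off // eq_sym.
move: trW; rewrite /mxtrace (eq_bigr (fun=> W i i)) => [|k _]; last exact: diag.
rewrite sumr_const card_ord => /eqP; rewrite mulrn_eq0 => /orP[/eqP n0|/eqP //].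
by have := ltn_ord i; rewrite {2}n0.
Qed.

End SquareZero.

(** * Alternating forms with a prescribed radical *)

Section Bivectors.
Variables (K : numFieldType) (V : vectType K).

Lemma linear_sumZ m (f : V -> K) (r : 'I_m -> K) (e : 'I_m -> V) :
  linear (f : V -> K^o) -> f (\sum_k r k *: e k) = \sum_k r k * f (e k).
Proof.
move=> lf.
have fD x y : f (x + y) = f x + f y by have := lf 1 x y; rewrite !scale1r.
have f0 : f 0 = 0 by apply: (addrI (f 0)); rewrite -fD !addr0.
rewrite (big_morph f fD f0); apply: eq_bigr => k _.
by have := lf (r k) (e k) 0; rewrite f0 !addr0.
Qed.

(** The values s_i(a) determine a modulo the radical of [B], so [B] factors through them in both
    arguments; antisymmetrizing its matrix yields wedges of the s_i. *)
Lemma alternating_form_factor m (s : 'I_m -> 'Hom(V, K^o)) (B : V -> V -> K) :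
  (forall b, linear (fun a => B a b : K^o)) ->
  (forall a b, B b a = - B a b) ->
  (forall a, (forall i, s i a = 0) -> forall b, B a b = 0) ->
  exists beta : 'I_m -> 'I_m -> K, forall a b,
    B a b = \sum_i \sum_j beta i j * (s i a * s j b - s i b * s j a).
Proof.
move=> linB alt kerB.
pose S0 (a : V) : 'rV[K]_m := \row_k s k a.
have S0_lin : linear S0.
  by move=> t a b; apply/rowP => k; rewrite !mxE linearP.
pose S0L := GRing.isLinear.Build K V 'rV[K]_m _ S0 S0_lin.
pose S := linfun (HB.pack_for {linear V -> 'rV[K]_m} S0 S0L).
have SE a k : S a 0 k = s k a by rewrite lfunE mxE.
(* A generalized inverse: S P S = S, so P(S a) and a differ by a vector of the radical. *)
pose P r := (S^-1)%VF r.
have BP a b : B a b = B (P (S a)) b.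
  have SP : S (P (S a)) = S a by rewrite /P -!comp_lfunE inv_lfun_def.
  have := linB b (-1) (P (S a)) a; rewrite !scaleN1r addrC kerB => [|k].
    by move/esym/eqP; rewrite subr_eq0 => /eqP.
  by rewrite -SE addrC linearB /= SP subrr mxE.
have PE r : P r = \sum_k r 0 k *: P (delta_mx 0 k).
  rewrite {1}[r]row_sum_delta /P linear_sum; apply: eq_bigr => k _; exact: linearZ.
pose G k l := B (P (delta_mx 0 k)) (P (delta_mx 0 l)).
have BE a b : B a b = \sum_k \sum_l s k a * (s l b * G k l).
  rewrite alt BP -alt BP (PE (S a)) (linear_sumZ _ _ (linB _)).
  apply: eq_bigr => k _; rewrite SE -mulr_sumr; congr (_ * _).
  rewrite alt (PE (S b)) (linear_sumZ _ _ (linB _)) -sumrN.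
  by apply: eq_bigr => l _; rewrite SE -mulrN -alt.
(* The half comes from averaging B(a, b) and -B(b, a). *)
exists (fun k l => G k l / 2) => a b.
rewrite -[LHS](mulfK (_ : 2%:R != 0)) ?pnatr_eq0 // mulr_natr mulr2n {2}alt.
rewrite (BE a b) (BE b a) -sumrB mulr_suml; apply: eq_bigr => k _.
rewrite -sumrB mulr_suml; apply: eq_bigr => l _.
by ring.
Qed.

End Bivectors.

(** * Restriction of the bracket to the orbits *)

Theorem proposition3p5 (R : realType) (n : nat)
    (phi : sl R[i] n -> sl R[i] n -> Sg R[i] n)
    (f : Sg R[i] n -> Sg R[i] n -> Sg R[i] n) :
  invariant_wedge2_S2 phi -> extends f phi ->
  forall x : sl_dual R[i] n, strongly_restricted f (coadj_orbit x).
Proof.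
move=> phi_inv [_ f_phi] x y.
have [Y Y0 ->] := trace_dual_surj y => xY.
pose I := ('I_n * 'I_n * bool)%type.
pose c (k : 'I_#|{: I}|) := square0_root R[i] (enum_val k).
pose s k := trace_dual (mxcomm (c k) Y).
have [[phi1 phi2] phi_alt _ _] := phi_inv.
have evalB a b : bivector_at f (trace_dual Y) a b = sym_eval (trace_dual Y) (phi a b).
  by rewrite /bivector_at f_phi.
have [] := @alternating_form_factor _ _ _ s (bivector_at f (trace_dual Y)).
- by move=> b t a a'; rewrite !evalB phi1 /sym_eval linearP.
- move=> a b; rewrite !evalB /sym_eval -mevalN; congr (meval _ _).
  apply/eqP; rewrite -addr_eq0 -(phi_alt (a + b)).
  have := phi1 (a + b) 1 a b; rewrite !scale1r => ->.
  have := phi2 a 1 a b; have := phi2 b 1 a b; rewrite !scale1r => -> ->.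
  by rewrite !phi_alt add0r addr0 addrC.
- move=> a sa b; rewrite evalB eval_comm_eq0 //.
  (* The vanishing of all [s k] at [a] says that [a] is conormal to the orbit at Y. *)
  apply: root_comm_eq0 => p.
  by have := sa (enum_rank p); rewrite /s trace_dualE /c enum_rankK.
move=> beta betaE.
pose J := ('I_#|{: I}| * 'I_#|{: I}|)%type.
exists #|{: J}|, (fun k => beta (enum_val k).1 (enum_val k).2 *: s (enum_val k).1),
  (fun k => s (enum_val k).2).
split=> [k|a b].
  split; last by apply: tangent_coadj_orbit => //; exact: square0_rootP.
  (* The coefficient is absorbed into the square-zero matrix, whose multiples are again square-zero,
     so the scaled vector is itself a velocity. *)
  have -> : beta (enum_val k).1 (enum_val k).2 *: s (enum_val k).1
     = trace_dual (mxcomm (beta (enum_val k).1 (enum_val k).2 *: c (enum_val k).1) Y).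
    apply/lfunP => a; rewrite scale_lfunE !trace_dualE /mxcomm.
    by rewrite -scalemxAl -scalemxAr -scalerBr -scalemxAl linearZ.
  apply: tangent_coadj_orbit => //.
  by rewrite -scalemxAl -scalemxAr square0_rootP !scaler0.
rewrite betaE pair_bigA /= big_enum_val /=; apply: eq_bigr => k _.
by rewrite !scale_lfunE mulrBr !mulrA.
Qed.
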